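(* Let $P$ be a finite unmixed poset of rank $r$ and $[r]=\{1,\ldots,r\}$. (1) If $P$ is graded then for any subset $S=\{i,i+1,\ldots,i+j\}$ of $[r]$, the partial flag ideal $\mathcal{F}(P,S)$ is unmixed. (2) If $P$ is pure then for any subset $S\subseteq[r]$, $\mathcal{F}(P,S)$ is unmixed.
   Context: Let $\Bbbk$ be a field. A finite poset $P$ is graded if it has a rank function $r_P:P\to\mathbb{N}$ with $r_P(p)=1$ for every minimal element $p$ and $r_P(q)=r_P(p)+1$ whenever $q$ covers $p$; the rank of $P$ is $\max\{r_P(p): p\in P\}$. $P$ is pure if all its maximal elements have the same rank (equivalently, all maximal chains have the same length). The flag ideal $\mathcal{F}(P)\subseteq\Bbbk[x_p: p\in P]$ is generated by all monomials $x_{p_1}\cdots x_{p_n}$ with $p_1<\cdots<p_n$ a maximal chain of $P$. For $S\subseteq[r]$, $P_S$ is the induced subposet of $P$ on $\{p\in P: r_P(p)\in S\}$ and $\mathcal{F}(P,S)=\mathcal{F}(P_S)$. A vertex cover of $P$ is a subset of $P$ meeting every maximal chain of $P$; $P$ is unmixed if all its inclusion-minimal vertex covers have the same cardinality. An ideal $I$ of a Noetherian ring $R$ is unmixed if its height equals the height of every associated prime of $R/I$; $\mathcal{F}(P)$ is unmixed iff $P$ is unmixed. *)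

(* Defs.v *)
From HB Require Import structures.
From mathcomp Require Import all_boot all_order all_algebra ring_quotient.
From mathcomp Require Import boolp classical_sets.
From mathcomp Require Import mpoly.

Set Implicit Arguments.
Unset Strict Implicit.
Unset Printing Implicit Defensive.

Import Order.TTheory GRing.Theory.

Local Open Scope ring_scope.
Local Open Scope classical_set_scope.

Section Posets.
Context {d : Order.disp_t} {P : finPOrderType d}.
Implicit Types (p q : P) (C V : {set P}).

Definition covered_by p q : bool :=
  (p < q)%O && [forall z : P, ~~ (p < z < q)%O].

Definition minimal_elt p : bool := [forall q : P, ~~ (q < p)%O].
Definition maximal_elt p : bool := [forall q : P, ~~ (p < q)%O].

(* Ranks start at 1. *)
Definition rank_function (rk : P -> nat) : Prop :=
  (forall p, minimal_elt p -> rk p = 1%N) /\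
  (forall p q, covered_by p q -> rk q = (rk p).+1).

Definition poset_rank (rk : P -> nat) : nat := (\max_(p : P) rk p)%N.

Definition pure (rk : P -> nat) : Prop :=
  rank_function rk /\
  (forall p q, maximal_elt p -> maximal_elt q -> rk p = rk q).

Definition chain C : bool := [forall p in C, forall q in C, (p >=< q)%O].

(* The empty chain is maximal exactly when P is empty. *)
Definition maximal_chain C : bool := maxset chain C.

Definition vertex_cover V : bool :=
  [forall C : {set P}, maximal_chain C ==> (V :&: C != finset.set0)].

Definition minimal_vertex_cover V : bool := minset vertex_cover V.

End Posets.

Definition unmixed_poset d (P : finPOrderType d) : Prop :=
  forall V W : {set P},
    minimal_vertex_cover V -> minimal_vertex_cover W -> #|V| = #|W|.

Section RankSelection.
Context {d : Order.disp_t} {P : finPOrderType d}.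

Definition rank_selected (rk : P -> nat) (S : pred nat) : Type :=
  {p : P | S (rk p)}.

Variables (rk : P -> nat) (S : pred nat).

HB.instance Definition _ := SubFinite.on (rank_selected rk S).
HB.instance Definition _ :=
  [SubChoice_isSubPOrder of rank_selected rk S by <: with d].

End RankSelection.

Section Ideals.
Context {R : comNzRingType}.
Implicit Types I Q G : set R.

Definition ideal_gen G : set R :=
  [set f | exists s : seq (R * R),
     (forall u, u \in s -> G u.2) /\ f = \sum_(u <- s) u.1 * u.2].

(* [idealr_closed] includes properness, so prime ideals are proper. *)
Definition prime_ideal Q : Prop :=
  idealr_closed (mem Q) /\ prime_idealr_closed (mem Q).

(* A chain c 0 < c 1 < ... < c n = Q of prime ideals. *)
Definition prime_chain (n : nat) (c : nat -> set R) Q : Prop :=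
  [/\ forall i, (i <= n)%N -> prime_ideal (c i),
      forall i, (i < n)%N -> c i `<` c i.+1 & c n = Q].

(* Supremum of a nonempty set of naturals in N + {oo}, with None as oo. *)
Definition sup_nat (E : set nat) : option nat :=
  match pselect (exists m, E m /\ forall n, E n -> (n <= m)%N) with
  | left ex => Some (projT1 (cid ex))
  | right _ => None
  end.

Definition prime_height Q : option nat :=
  sup_nat [set n | exists c, prime_chain n c Q].

(* The infimum of the heights of the primes containing I, computed as the
   largest lower bound; the unit ideal has height oo. *)
Definition ideal_height I : option nat :=
  sup_nat [set n | forall Q, prime_ideal Q -> I `<=` Q ->
    if prime_height Q is Some m then (n <= m)%N else true].

(* Q is a prime ideal and the annihilator of the class of f in R/I. *)
Definition associated_prime I Q : Prop :=
  prime_ideal Q /\ exists f : R, Q = [set g | I (g * f)].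

Definition unmixed_ideal I : Prop :=
  forall Q, associated_prime I Q -> ideal_height I = prime_height Q.

End Ideals.

Section FlagIdeals.
Variable k : fieldType.

(* The polynomial ring k[x_p : p in P] is {mpoly k[#|P|]}, the variable x_p
   being the one indexed by [enum_rank p]. *)
Definition flag_ideal d (P : finPOrderType d) : set {mpoly k[#|P|]} :=
  ideal_gen [set m | exists2 C : {set P}, maximal_chain C &
                     m = \prod_(p in C) 'X_(enum_rank p)].

Arguments flag_ideal {d} P _.

Definition partial_flag_ideal d (P : finPOrderType d) (rk : P -> nat)
    (S : pred nat) : set {mpoly k[#|{: rank_selected rk S}|]} :=
  flag_ideal (rank_selected rk S).

End FlagIdeals.

Arguments flag_ideal k {d} P _.
Arguments partial_flag_ideal k {d P} rk S _.

(* Main.v *)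
(* The associated primes of a squarefree monomial ideal are generated by sets
   of variables, namely the minimal vertex covers, so F(P) is unmixed as soon
   as all minimal covers V have the same size, provided that the prime
   generated by the variables of V has height #|V|.  For the height, a chain of
   primes ending at V extends to one ending at the ideal of all variables; going
   down a chain of primes each step gives one more algebraically independent
   element, and a polynomial ring in N variables has at most N of those.

   On the combinatorial side, let T be the set of maximal elements of P whose
   rank is below S.  If no rank in S is skipped by the other maximal chains,
   the latter restrict onto the maximal chains of P_S, and V |-> V u T sends
   minimal covers of P_S to minimal covers of P. *)

Require Import Defs.
From HB Require Import structures.
From mathcomp Require Import all_boot all_order all_algebra ring_quotient.
From mathcomp Require Import boolp classical_sets.
From mathcomp Require Import mpoly.

Set Implicit Arguments.
Unset Strict Implicit.
Unset Printing Implicit Defensive.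

Import Order.TTheory GRing.Theory.

Local Open Scope ring_scope.

(** * Splitting off the last variable of a polynomial *)

Local Notation widen := (widen_ord (leqnSn _)).

Lemma widen_lift n (i : 'I_n) : widen i = lift ord_max i.
Proof. by apply/ord_inj; rewrite lift_max. Qed.

(** Gives the injectivity of [muni]: the exponent of the last variable and the inner monomial
    together determine [m]. *)
Lemma coef_muni (n : nat) (R : nzRingType) (p : {mpoly R[n.+1]}) (m : 'X_{1.. n.+1}) :
  ((muni p)`_(m ord_max))@_[multinom m (widen i) | i < n] = p@_m.
Proof.
rewrite muniE coef_sum raddf_sum /=.
have step (m' : 'X_{1..n.+1}) :
    ((p@_m' *: 'X_[[multinom m' (widen i) | i < n]] *: 'X^(m' ord_max))`_(m ord_max)
      )@_[multinom m (widen i) | i < n] = p@_m' * (m' == m)%:R.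
  rewrite coefZ coefXn; have [->|nem] := eqVneq m' m.
    by rewrite eqxx mulr1 mcoeffZ mcoeffX eqxx mulr1.
  have [eql|_] := eqVneq (m ord_max) (m' ord_max); last first.
    by rewrite mulr0 mcoeff0 mulr0.
  rewrite !mulr1 mcoeffZ mcoeffX; case: eqP => // /mnmP eqr; case/eqP: nem.
  apply/mnmP => i; have [j ->|->] := unliftP ord_max i; last by [].
  by have := eqr j; rewrite !mnmE widen_lift.
rewrite (eq_bigr _ (fun m' _ => step m')).
have [mp|mNp] := boolP (m \in msupp p).
  rewrite (bigD1_seq m) ?msupp_uniq //= eqxx mulr1 big1 ?addr0 // => m' /negbTE->.
  by rewrite mulr0.
rewrite (memN_msupp_eq0 mNp) big_seq big1 // => m' m'p.
by case: eqP m'p mNp => [->->|]; rewrite ?mulr0.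
Qed.

Lemma muni_inj (n : nat) (R : nzRingType) : injective (@muni n R).
Proof. by move=> p q eqpq; apply/mpolyP => m; rewrite -!coef_muni eqpq. Qed.

(** Evaluation in two stages, the last variable last, so that a relation can be treated as a
    univariate polynomial in it. *)
Lemma mmap_muni (n : nat) (R : nzRingType) (S : comNzRingType)
    (f : {rmorphism R -> S}) (t : 'I_n.+1 -> S) (p : {mpoly R[n.+1]}) :
  mmap f t p = (map_poly (mmap f (t \o widen)) (muni p)).[t ord_max].
Proof.
rewrite muniE rmorph_sum /= horner_sum; apply: eq_bigr => m _.
rewrite map_polyZ /= map_polyXn hornerZ hornerXn mmapZ mmapX /mmap1.
rewrite big_ord_recr /= mulrA; congr (_ * _ * _).
by apply: eq_bigr => i _; rewrite mnmE.
Qed.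

(** * Elementary properties of prime ideals *)

Section Ideals.
Variables (R : comNzRingType) (Q : set R).
Hypothesis primeQ : prime_ideal Q.

Lemma prime_ideal0 : Q 0.
Proof. by case: primeQ => [[]]; rewrite in_setE. Qed.

Lemma prime_ideal1 : ~ Q 1.
Proof. by case: primeQ => [[_]]; rewrite notin_setE. Qed.

Lemma prime_idealMD a u v : Q u -> Q v -> Q (a * u + v).
Proof.
case: primeQ => [[_ _ clQ] _ Qu Qv]; have := clQ a u v.
by rewrite !in_setE; apply.
Qed.

Lemma prime_idealMl a u : Q u -> Q (a * u).
Proof. by move=> Qu; rewrite -[_ * _]addr0; apply/prime_idealMD/prime_ideal0. Qed.

Lemma prime_idealMr a u : Q u -> Q (u * a).
Proof. by rewrite mulrC; apply: prime_idealMl. Qed.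

Lemma prime_idealDr u v : Q u -> Q (u + v) -> Q v.
Proof.
by move=> Qu Quv; rewrite -[v](addKr u) -mulN1r; apply: prime_idealMD.
Qed.

Lemma prime_idealM u v : Q (u * v) -> Q u \/ Q v.
Proof.
case: primeQ => _ pQ; have := pQ u v; rewrite !in_setE => pr Quv.
by case/orP: (pr Quv); rewrite in_setE; [left | right].
Qed.

Lemma prime_ideal_prod (I : Type) (r : seq I) (A : pred I) (F : I -> R) :
  Q (\prod_(i <- r | A i) F i) -> exists2 i, A i & Q (F i).
Proof.
elim: r => [|i r IH]; first by rewrite big_nil => /prime_ideal1.
rewrite big_cons; case: ifP => // Ai /prime_idealM[Qi|/IH //].
by exists i.
Qed.

End Ideals.

(** * Chains of primes and algebraic independence *)

Section Dimension.
Variables (k : fieldType) (N : nat).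
Implicit Types (Q : set {mpoly k[N]}).

(** Algebraic independence over [k] of the classes of the [t i] modulo [Q]. *)
Definition alg_indep Q (m : nat) (t : 'I_m -> {mpoly k[N]}) :=
  forall F : {mpoly k[m]}, Q (mmap (@mpolyC N k) t F) -> F = 0.

(* The new element s can be taken in Q' \ Q: cancelling powers of s from a
   relation modulo Q leaves a relation whose constant coefficient is a
   relation modulo Q'. *)
Lemma alg_indep_extend Q Q' m (t : 'I_m -> {mpoly k[N]}) :
  prime_ideal Q -> prime_ideal Q' -> (Q `<` Q')%classic -> alg_indep Q' t ->
  exists t' : 'I_m.+1 -> {mpoly k[N]}, alg_indep Q t'.
Proof.
move=> prQ prQ' [subQ /existsNP[s /not_implyP[Q's NQs]]] indt.
(* [s] goes to the last index, the one that [muni] splits off. *)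
pose t' i := oapp t s (unlift ord_max i).
have t't : t' \o widen =1 t.
  move=> i; rewrite /t' /=.
  by rewrite widen_lift liftK.
have t's : t' ord_max = s by rewrite /t' unlift_none.
exists t' => F; rewrite mmap_muni t's (funext t't) => QF.
apply: (@muni_inj _ _); rewrite muni0; elim/poly_ind: (muni F) QF => // p c IH.
rewrite rmorphD rmorphM /= map_polyX map_polyC /= hornerD hornerMX hornerC => QF.
have c0 : c = 0.
  apply: indt; apply: (prime_idealDr prQ' _ (subQ _ QF)).
  exact: prime_idealMl.
move: QF; rewrite c0 raddf0 addr0 => /(prime_idealM prQ)[/IH->|//].
by rewrite mul0r add0r.
Qed.

Lemma prime_chain_alg_indep n c Q : prime_chain n c Q ->
  exists t : 'I_n -> {mpoly k[N]}, alg_indep (c 0%N) t.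
Proof.
case=> prc ltc _.
suff indep j : (j <= n)%N ->
    exists t : 'I_j -> {mpoly k[N]}, alg_indep (c (n - j)%N) t.
  by have := indep n (leqnn n); rewrite subnn.
elim: j => [_|j IH ltjn].
  (* At the top of the chain there are no elements yet: a polynomial in zero variables is constant,
     and a nonzero constant is a unit. *)
  exists (fun=> 0) => F; have [->|nzF] := eqVneq F 0; first by [].
  have /msize1_polyC-> : (msize F <= 1)%N.
    rewrite msizeE; apply/bigmax_leqP_seq => m _ _.
    by rewrite mdegE big_ord0.
  rewrite mmapC => Qc; have [->|nzc] := eqVneq F@_0 0; first by rewrite mpolyC0.
  case: (prime_ideal1 (prc (n - 0)%N (leq_subr _ _))).
  have -> : 1 = ((F@_0)^-1)%:MP * (F@_0)%:MP :> {mpoly k[N]}.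
    by rewrite -mpolyCM mulVf.
  exact: (prime_idealMl (prc _ (leq_subr _ _))).
have [t indt] := IH (ltnW ltjn); have := ltc (n - j.+1)%N.
have := prc _ (leq_subr j.+1 n); rewrite subnSK // leq_subr => prQ /(_ isT) ltQ.
exact: alg_indep_extend prQ (prc _ (leq_subr j n)) ltQ indt.
Qed.

End Dimension.

(** * Algebraic dependence of more than [N] polynomials in [N] variables *)

Section Dependence.
Variables (k : fieldType) (N : nat).
Implicit Types (p q : {mpoly k[N]}).

(** [msize] is the degree plus one, and 0 at the zero polynomial; hence the successors. *)
Lemma msizeM_leD p q d d' :
  (msize p <= d.+1)%N -> (msize q <= d'.+1)%N -> (msize (p * q) <= (d + d').+1)%N.
Proof.
have [->|nzp] := eqVneq p 0; first by rewrite mul0r msize0.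
have [->|nzq] := eqVneq q 0; first by rewrite mulr0 msize0.
rewrite msizeM // => lep leq.
by rewrite -subn1 leq_subLR add1n -addnS -addSn leq_add.
Qed.

Lemma msize_mmap1 m (t : 'I_m -> {mpoly k[N]}) e (b : 'X_{1.. m}) :
  (forall i, msize (t i) <= e.+1)%N -> (msize (mmap1 t b) <= (e * mdeg b).+1)%N.
Proof.
move=> le_t; rewrite /mmap1 mdegE big_distrr /=.
elim/big_rec2: _ => [|i d p _ IH]; first by rewrite msize1.
apply: msizeM_leD => //; elim: (b i) => [|j IHj]; first by rewrite msize1.
by rewrite exprS mulnS msizeM_leD.
Qed.

(** Linear algebra by counting: row [i] of [M] lists coefficients of the value at [t] of one
    monomial with exponents below [D]. There are more rows than columns, and a nonzero vector in the
    left kernel gives the coefficients of [F]. *)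
Lemma mpoly_alg_dep m (t : 'I_m -> {mpoly k[N]}) : (N < m)%N ->
  exists2 F : {mpoly k[m]}, F != 0 & mmap (@mpolyC N k) t F = 0.
Proof.
move=> ltNm; pose e := (\max_i msize (t i))%N; pose B := (m * e).+1.
(* D is chosen so that (D * B) ^ N < D ^ m, where the value of a monomial with
   exponents in [0, D) only involves monomials with exponents in [0, D * B). *)
pose D := (B ^ N).+1.
pose mon n r (f : {ffun 'I_n -> 'I_r}) := [multinom (f i : nat) | i < n].
pose rows := {ffun 'I_m -> 'I_D}; pose cols := {ffun 'I_N -> 'I_(D * B)}.
pose M := \matrix_(i < #|{: rows}|, j < #|{: cols}|)
  (mmap1 t (mon _ _ (enum_val i)))@_(mon _ _ (enum_val j)).
have ltcr : (#|{: cols}| < #|{: rows}|)%N.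
  rewrite !card_ffun !card_ord expnMn.
  apply: (@leq_trans (D ^ N.+1)); last by rewrite leq_exp2l ?ltnS ?expn_gt0.
  by rewrite expnSr ltn_pmul2l ?expn_gt0.
have /rowV0Pn[v /sub_kermxP vM nzv] : kermx M != 0.
  by rewrite kermx_eq0 /row_free ltn_eqF // (leq_ltn_trans (rank_leq_col _)).
pose F : {mpoly k[m]} := \sum_i v 0 i *: 'X_[mon _ _ (enum_val i)].
have mon_inj n r : injective (mon n r).
  move=> f g /mnmP eqfg; apply/ffunP => i; apply/val_inj.
  by have := eqfg i; rewrite !mnmE.
exists F.
  case/rV0Pn: nzv => i nzvi; apply: contraNneq nzvi => /mpolyP/(_ (mon _ _ (enum_val i))).
  rewrite mcoeff0 raddf_sum /= (bigD1 i) //= mcoeffZ mcoeffX eqxx mulr1.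
  rewrite big1 ?addr0 => [-> //|j neji]; rewrite mcoeffZ mcoeffX.
  by rewrite (inj_eq (@mon_inj _ _)) (inj_eq enum_val_inj) (negbTE neji) mulr0.
have le_t i : (msize (t i) <= e.+1)%N by apply/leqW/leq_bigmax.
apply/mpolyP => b; rewrite mcoeff0 rmorph_sum raddf_sum /=.
have [/forallP ltb|] := boolP [forall i, (b i < D * B)%N].
  pose g : cols := [ffun i => Ordinal (ltb i)].
  have bg : b = mon _ _ g by apply/mnmP => i; rewrite mnmE ffunE.
  have /rowP/(_ (enum_rank g)) := vM; rewrite !mxE => vMg.
  rewrite -[RHS]vMg; apply: eq_bigr => i _.
  by rewrite mmapZ mmapX mul_mpolyC mcoeffZ mxE enum_rankK -bg.
(* An exponent of at least [D * B] already exceeds the degree of every value involved. *)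
rewrite negb_forall => /existsP[i0]; rewrite -leqNgt => leb.
apply: big1 => i _; rewrite mmapZ mmapX mul_mpolyC mcoeffZ.
rewrite memN_msupp_eq0 ?mulr0 // msize_mdeg_ge //.
apply: leq_trans (msize_mmap1 _ le_t) _.
apply: (@leq_trans (D * B)); last by rewrite mdegE (leq_trans leb) // (bigD1 i0) //= leq_addr.
have lesum : (mdeg (mon _ _ (enum_val i)) <= m * B ^ N)%N.
  rewrite mdegE -[X in (X * _)%N]card_ord -sum_nat_const.
  by apply: leq_sum => j _; rewrite mnmE -ltnS.
rewrite mulSn -addn1 [leqRHS]addnC leq_add //.
apply: (@leq_trans (e * (m * B ^ N))); first by rewrite leq_mul2l lesum orbT.
by rewrite mulnA [leqRHS]mulnC leq_mul2r mulnC leqnSn orbT.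
Qed.

End Dependence.

(** * Heights and extension of prime chains *)

Section Heights.
Variable R : comNzRingType.
Implicit Types (Q : set R) (E : set nat).

Lemma sup_nat_Some E n : sup_nat E = Some n -> E n /\ forall m, E m -> (m <= n)%N.
Proof. by rewrite /sup_nat; case: pselect => // ex [<-]; case: cid. Qed.

Lemma sup_nat_max E n : E n -> (forall m, E m -> (m <= n)%N) -> sup_nat E = Some n.
Proof.
move=> En ubn; rewrite /sup_nat; case: pselect => [ex|[]]; last by exists n.
case: cid => m /= [Em ubm]; congr Some; apply/eqP.
by rewrite eqn_leq ubn ?ubm.
Qed.

Lemma prime_chain_ext n c Q Q' : prime_chain n c Q -> prime_ideal Q' ->
  (Q `<` Q')%classic -> exists c', prime_chain n.+1 c' Q'.
Proof.
move=> [prc ltc cn] prQ' ltQQ'.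
exists (fun i => if (i <= n)%N then c i else Q'); split=> [i|i|].
- by case: ifP => [lein _|//]; apply: prc.
- rewrite ltnS => lein; rewrite lein; case: (ltnP i n) => [/ltc //|leni].
  by rewrite (_ : i = n) ?cn //; apply/eqP; rewrite eqn_leq lein.
- by rewrite ltnn.
Qed.

End Heights.

(** * Primes generated by variables and their heights *)

Section VariableIdeals.
Variables (k : fieldType) (T : finType).
Implicit Types (V W : {set T}) (f g : {mpoly k[#|T|]}).

Local Notation var p := ('X_(enum_rank p) : {mpoly k[#|T|]}).

(** The dimension bound: a longer chain would give more than [#|T|] independent elements modulo its
    first prime. *)
Lemma prime_chain_leq n c (Q : set {mpoly k[#|T|]}) : prime_chain n c Q -> (n <= #|T|)%N.
Proof.
move=> ch; rewrite leqNgt; apply/negP => lt.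
have [t indt] := prime_chain_alg_indep ch.
have [F /eqP nzF F0] := mpoly_alg_dep t lt; apply/nzF/indt; rewrite F0.
by apply: prime_ideal0; case: ch => prc _ _; apply: prc.
Qed.

Definition kill_vars V : {mpoly k[#|T|]} -> {mpoly k[#|T|]} :=
  mmap (@mpolyC _ k) (fun i => if enum_val i \in V then 0 else 'X_i).

HB.instance Definition _ V := GRing.RMorphism.on (kill_vars V).

(** The ideal generated by the variables in [V], encoded as the kernel of an endomorphism of a
    domain, which makes it prime at once. *)
Definition var_ideal V : set {mpoly k[#|T|]} := [set f | kill_vars V f = 0]%classic.

Lemma kill_varsX V m :
  kill_vars V 'X_[m] =
    if [exists p in V, m (enum_rank p) != 0%N] then 0 else 'X_[m].
Proof.
rewrite /kill_vars mmapX /mmap1; case: ifP => [/exists_inP[p Vp nzp]|/negbT].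
  by rewrite (bigD1 (enum_rank p)) //= enum_rankK Vp expr0n (negbTE nzp) mul0r.
rewrite negb_exists_in => /forall_inP m0; rewrite [RHS]mpolyXE_id.
apply: eq_bigr => i _; case: ifP => // /m0; rewrite negbK enum_valK => /eqP->.
by rewrite !expr0.
Qed.

Lemma mcoeff_kill_vars V f m :
  (kill_vars V f)@_m =
    if [exists p in V, m (enum_rank p) != 0%N] then 0 else f@_m.
Proof.
elim/mpolyind: f => [|c m' f _ _ IH]; first by rewrite raddf0 mcoeff0 if_same.
rewrite raddfD /= !mcoeffD IH {1}/kill_vars mmapZ -/(kill_vars V _) kill_varsX.
rewrite mul_mpolyC !mcoeffZ !mcoeffX (fun_if (mcoeff m)) mcoeff0 mcoeffX.
by case: eqP => [->|_]; do 2?[case: ifP => _]; rewrite ?(mulr0, add0r).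
Qed.

(** [kill_vars] erases the monomials that involve [V] and leaves the others unchanged, so nothing
    cancels. *)
Lemma var_idealP V f : var_ideal V f <->
  forall m, m \in msupp f -> exists2 p, p \in V & m (enum_rank p) != 0%N.
Proof.
split=> [Vf m fm|Vf].
  apply/exists_inP; move: fm; rewrite mcoeff_msupp; apply: contraNT => /negbTE Nex.
  by have := mcoeff_kill_vars V f m; rewrite Nex Vf mcoeff0 => <-.
apply/mpolyP => m; rewrite mcoeff_kill_vars mcoeff0; case: ifPn => // Nex.
apply: memN_msupp_eq0; apply: contraNN Nex => /Vf ex; exact/exists_inP.
Qed.

Lemma var_ideal_prime V : prime_ideal (var_ideal V).
Proof.
split; [split; rewrite ?in_setE ?notin_setE /= |].
- exact: raddf0.
- by rewrite /var_ideal /= rmorph1; apply/eqP/oner_neq0.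
- move=> a u v; rewrite !in_setE /var_ideal /= rmorphD rmorphM /= => -> ->.
  by rewrite mulr0 addr0.
- move=> u v; rewrite in_setE /var_ideal /= rmorphM => /eqP.
  by rewrite mulf_eq0 => /orP[] /eqP eq0; apply/orP; [left|right]; rewrite in_setE.
Qed.

Lemma var_ideal_var V p : var_ideal V (var p) <-> p \in V.
Proof.
rewrite var_idealP; split=> [/(_ U_(enum_rank p)%MM)|Vp m].
  rewrite msuppX inE => /(_ (eqxx _))[q Vq].
  by rewrite mnm1E eqb0 negbK => /eqP/enum_rank_inj->.
by rewrite msuppX inE => /eqP->; exists p; rewrite ?mnm1E ?eqxx.
Qed.

Lemma var_ideal_subset V (Q : set {mpoly k[#|T|]}) : prime_ideal Q ->
  (forall p, p \in V -> Q (var p)) -> (var_ideal V `<=` Q)%classic.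
Proof.
move=> prQ QV f /var_idealP Vf; rewrite (mpolyE f) big_seq.
elim/big_rec: _ => [|m g /Vf[p Vp nzp] Qg]; first exact: prime_ideal0.
rewrite -mul_mpolyC; apply: prime_idealMD => //.
rewrite mpolyXE_id (bigD1 (enum_rank p)) //= -(prednK (_ : 0 < m _)%N) ?lt0n //.
by rewrite exprS -mulrA; apply: prime_idealMr => //; apply: QV.
Qed.

(** The elements of [W :\: V] are adjoined one at a time; each inclusion is strict because the new
    variable was not in the previous ideal. *)
Lemma var_ideal_chain n c V W : V \subset W -> prime_chain n c (var_ideal V) ->
  exists c', prime_chain (n + #|W :\: V|) c' (var_ideal W).
Proof.
move E: #|W :\: V| => e; elim: e n c V E => [|e IH] n c V E subVW chV.
  exists c; rewrite addn0 (_ : W = V) //; apply/eqP; rewrite finset.eqEsubset subVW andbT.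
  by rewrite -finset.setD_eq0 -cards_eq0 E.
have /card_gt0P[p] : (0 < #|W :\: V|)%N by rewrite E.
rewrite inE => /andP[VNp Wp].
have [|c1 ch1] := @prime_chain_ext _ n c _ (var_ideal (p |: V)) chV (var_ideal_prime _).
  split=> [|/(_ (var p))].
    apply: var_ideal_subset => [|q Vq]; first exact: var_ideal_prime.
    by apply/var_ideal_var; rewrite !inE Vq orbT.
  by rewrite !var_ideal_var finset.setU11 (negbTE VNp) => /(_ isT).
rewrite -addSnnS; apply: IH ch1; last by rewrite finset.subUset finset.sub1set Wp.
have -> : W :\: (p |: V) = (W :\: V) :\ p by apply/setP => q; rewrite !inE negb_or andbA.
by have := cardsD1 p (W :\: V); rewrite E inE VNp Wp => -[].
Qed.

(* The chain 0 < ... < var_ideal V continues up to the maximal ideal of all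
   the variables, so that #|T| + 1 algebraically dependent elements bound it. *)
Lemma var_ideal_height V : prime_height (var_ideal V) = Some #|V|.
Proof.
apply: sup_nat_max => [|n [c ch]].
  have [|c ch] := @var_ideal_chain 0 (fun=> var_ideal finset.set0) _ V (finset.sub0set V).
    by split=> // i _; apply: var_ideal_prime.
  by exists c; move: ch; rewrite finset.setD0.
have [c' /prime_chain_leq] := var_ideal_chain (finset.subsetT V) ch.
by rewrite finset.setTD -(cardsC V) leq_add2r.
Qed.

End VariableIdeals.

Arguments var_ideal k {T} V _.
Arguments var_ideal_prime k {T} V.
Arguments var_ideal_height k {T} V.

(** * Ideals given by generators *)

Section GeneratedIdeals.
Variable R : comNzRingType.
Implicit Types (G Q : set R).

Lemma ideal_gen_mem G f : G f -> ideal_gen G f.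
Proof.
move=> Gf; exists [:: (1, f)]; rewrite big_seq1 mul1r; split=> // u.
by rewrite inE => /eqP->.
Qed.

Lemma ideal_gen0 G : ideal_gen G 0.
Proof. by exists [::]; rewrite big_nil; split. Qed.

Lemma ideal_genMD G a f g : ideal_gen G f -> ideal_gen G g -> ideal_gen G (a * f + g).
Proof.
move=> [s [Gs ->]] [s' [Gs' ->]]; exists ([seq (a * u.1, u.2) | u <- s] ++ s').
split=> [u|].
  by rewrite mem_cat => /orP[/mapP[v /Gs Gv ->]|/Gs'].
rewrite big_cat big_map big_distrr /=; congr (_ + _).
by apply: eq_bigr => u _; rewrite mulrA.
Qed.

Lemma ideal_gen_subset G Q : prime_ideal Q -> (G `<=` Q)%classic ->
  (ideal_gen G `<=` Q)%classic.
Proof.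
move=> prQ subGQ f [s [Gs ->]]; rewrite big_seq.
elim/big_rec: _ => [|u g /Gs/subGQ Qu]; first exact: prime_ideal0.
exact: prime_idealMD.
Qed.

End GeneratedIdeals.

(** * Flag ideals, their associated primes and vertex covers *)

Section FlagIdeal.
Variables (k : fieldType) (d : Order.disp_t) (P : finPOrderType d).
Implicit Types (C V W : {set P}) (f g : {mpoly k[#|P|]}).

Local Notation var p := ('X_(enum_rank p) : {mpoly k[#|P|]}).

Lemma meets_maximal_chain V C : vertex_cover V -> maximal_chain C ->
  exists2 p, p \in V & p \in C.
Proof.
move=> /forallP/(_ C)/implyP covV /covV/finset.set0Pn[p].
by rewrite inE => /andP[Vp Cp]; exists p.
Qed.

Lemma vertex_coverP V :
  (forall C, maximal_chain C -> exists2 p, p \in V & p \in C) -> vertex_cover V.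
Proof.
move=> covV; apply/forallP => C; apply/implyP => /covV[p Vp Cp].
by apply/finset.set0Pn; exists p; rewrite inE Vp.
Qed.

Lemma flag_ideal_subset V : vertex_cover V -> (flag_ideal k P `<=` var_ideal k V)%classic.
Proof.
move=> covV; apply: ideal_gen_subset; first exact: var_ideal_prime.
move=> _ [C maxC ->]; have [p Vp Cp] := meets_maximal_chain covV maxC.
rewrite (bigD1 p) //=; apply: prime_idealMr; first exact: var_ideal_prime.
exact/var_ideal_var.
Qed.

Lemma prime_vertex_cover Q : prime_ideal Q -> (flag_ideal k P `<=` Q)%classic ->
  vertex_cover [set p | `[< Q (var p) >]].
Proof.
move=> prQ subQ; apply: vertex_coverP => C maxC.
have : Q (\prod_(p in C) var p) by apply/subQ/ideal_gen_mem; exists C.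
by case/(prime_ideal_prod prQ) => p Cp Qp; exists p; rewrite // inE; apply/asboolP.
Qed.

(** The hard inclusion in writing the flag ideal as the intersection of the [var_ideal k V]. For a
    monomial [m] of [f], the variables absent from [m] contain no minimal cover, hence do not form a
    cover; so some maximal chain avoids them, and its product divides [m]. *)
Lemma mem_flag_ideal f :
  (forall V, minimal_vertex_cover V -> var_ideal k V f) -> flag_ideal k P f.
Proof.
move=> covf; rewrite (mpolyE f) big_seq.
elim/big_rec: _ => [|m g fm Ig]; first exact: ideal_gen0.
rewrite -mul_mpolyC; apply: ideal_genMD => //.
pose V := [set p | m (enum_rank p) == 0%N].
have [covV|] := boolP (vertex_cover V).
  have [W minW subWV] := minset_exists covV.
  have /var_idealP/(_ m fm)[p Wp] := covf _ minW.
  by have := fintype.subsetP subWV _ Wp; rewrite inE => ->.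
rewrite negb_forall => /existsP[C]; rewrite negb_imply => /andP[maxC].
rewrite negbK => /eqP VC0.
have -> : 'X_[m] = 'X_[m - \sum_(p in C) U_(enum_rank p)] *
    \prod_(p in C) var p :> {mpoly k[#|P|]}.
  rewrite mprodXE -mpolyXD submK //; apply/mnm_lepP => i; rewrite mnm_sumE.
  have [Ci|NCi] := boolP (enum_val i \in C).
    rewrite (bigD1 (enum_val i)) //= enum_valK mnm1E eqxx big1 => [|p /andP[_ nep]].
      rewrite addn0 lt0n; apply/negP => m0.
      by have := finset.in_set0 (enum_val i); rewrite -VC0 !inE enum_valK m0 Ci.
    rewrite mnm1E; have [eqi|//] := eqVneq (enum_rank p) i.
    by rewrite -eqi enum_rankK eqxx in nep.
  rewrite big1 // => p Cp; rewrite mnm1E; have [eqi|//] := eqVneq (enum_rank p) i.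
  by rewrite -eqi enum_rankK Cp in NCi.
by rewrite -[_ * _]addr0; apply: ideal_genMD (ideal_gen0 _); apply: ideal_gen_mem; exists C.
Qed.

(** Prime avoidance among the minimal covers [V] whose ideal misses [f]. If each had a variable
    outside [Q], the product of these variables times [f] would lie in every [var_ideal], hence in
    the flag ideal, and the product would lie in [Q]. *)
Lemma associated_prime_flag_ideal Q : associated_prime (flag_ideal k P) Q ->
  exists2 V, minimal_vertex_cover V & Q = var_ideal k V.
Proof.
move=> [prQ [f defQ]].
pose A V := minimal_vertex_cover V && ~~ `[< var_ideal k V f >].
have [V /andP[minV /asboolPn NVf] QV] :
    exists2 V, A V & forall p, p \in V -> Q (var p).
  apply: contrapT => noV.
  (* The default 1 occurs only if all variables of [V] lie in [Q], which [noV] excludes on [A]. *)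
  pose F V := if [pick p in V | ~~ `[< Q (var p) >]] is Some p then var p else 1.
  suff FI : flag_ideal k P ((\prod_(V | A V) F V) * f).
    have : Q (\prod_(V | A V) F V) by rewrite {1}defQ.
    move=> /(prime_ideal_prod prQ)[V AV QF]; apply: noV; exists V => // p Vp.
    apply: contrapT => NQp; move: QF; rewrite /F.
    case: pickP => [q /andP[_ /asboolPn]//|/(_ p)].
    by rewrite Vp => /negbFE/asboolP.
  apply: mem_flag_ideal => W minW; have prW := var_ideal_prime k W.
  have [Wf|NWf] := pselect (var_ideal k W f); first exact: prime_idealMl.
  have AW : A W by rewrite /A minW; apply/asboolPn.
  rewrite (bigD1 W) //= -mulrA; apply: prime_idealMr => //; rewrite /F.
  case: pickP => [p /andP[Wp _]|noW]; first exact/var_ideal_var.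
  case: noV; exists W => // p Wp; have := noW p.
  by rewrite Wp => /negbFE/asboolP.
exists V => //; apply/seteqP; split=> [g|]; last exact: var_ideal_subset.
rewrite {1}defQ => Igf; have covV : vertex_cover V by case/minsetP: minV.
by case: (prime_idealM (var_ideal_prime k V) (flag_ideal_subset covV Igf)).
Qed.

(** Every prime above the flag ideal contains the ideal of a minimal cover, so its height is at
    least the common size of these covers; the associated prime itself attains this bound. *)
Lemma unmixed_flag_ideal : unmixed_poset P -> unmixed_ideal (flag_ideal k P).
Proof.
move=> unmP Q assQ; have [W minW defQ] := associated_prime_flag_ideal assQ.
have covW : vertex_cover W by case/minsetP: minW.
rewrite defQ var_ideal_height; apply: sup_nat_max => [Q' prQ' subQ'|n].
  have [V minV subV] := minset_exists (prime_vertex_cover prQ' subQ').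
  rewrite (unmP _ _ minW minV).
  have subVQ' : (var_ideal k V `<=` Q')%classic.
    apply: var_ideal_subset => // p /(fintype.subsetP subV).
    by rewrite inE => /asboolP.
  have [[c chV] _] := sup_nat_Some (var_ideal_height k V).
  case EQ': (prime_height Q') => [m|//]; have [_ ubQ'] := sup_nat_Some EQ'.
  (* A longest chain below [var_ideal k V] serves for [Q'] if the two coincide, and otherwise
     extends by [Q']. *)
  have [eqVQ'|neVQ'] := pselect (var_ideal k V = Q').
    by apply: ubQ'; exists c; rewrite -eqVQ'.
  have [|c' ch'] := prime_chain_ext chV prQ'.
    by split=> // subQ'V; apply: neVQ'; apply/seteqP.
  by apply: ltnW; apply: ubQ'; exists c'.
move=> /(_ _ (var_ideal_prime k W) (flag_ideal_subset covW)).
by rewrite var_ideal_height.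
Qed.

End FlagIdeal.

(** * Maximal chains, minimal covers and rank functions *)

Section Chains.
Variables (d : Order.disp_t) (P : finPOrderType d).
Implicit Types (C V W : {set P}) (p q : P).

Lemma chainP C : reflect {in C &, forall p q, (p >=< q)%O} (chain C).
Proof.
apply: (iffP forall_inP) => [chC p q Cp|chC p Cp].
  by move/forall_inP: (chC p Cp); apply.
by apply/forall_inP => q; apply: chC.
Qed.

Lemma maximal_chainP C :
  maximal_chain C <->
  chain C /\ forall q, (forall p, p \in C -> (p >=< q)%O) -> q \in C.
Proof.
split=> [/maxsetP[/chainP chC maxC]|[chC maxC]].
  split=> [|q compq]; first exact/chainP.
  rewrite -(maxC (q |: C)) ?finset.setU11 ?finset.subsetU1 //.
  apply/chainP => x y; rewrite !in_setU1.
  case/orP=> [/eqP->|Cx]; case/orP=> [/eqP->|Cy].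
  - exact: comparablexx.
  - by rewrite comparable_sym compq.
  - exact: compq.
  - exact: chC.
apply/maxsetP; split=> // B /chainP chB subCB; apply/eqP; rewrite finset.eqEsubset subCB andbT.
apply/fintype.subsetP => q Bq; apply: maxC => p Cp.
exact: chB (fintype.subsetP subCB _ Cp) Bq.
Qed.

(** The private chain of [p] is one left uncovered when [p] is removed from [V]. *)
Lemma minimal_vertex_coverP V :
  minimal_vertex_cover V <->
  vertex_cover V /\ forall p, p \in V -> exists2 C, maximal_chain C &
    forall q, q \in V -> q \in C -> q = p.
Proof.
split=> [/minsetP[covV minV]|[covV privV]].
  split=> // p Vp; have : ~~ vertex_cover (V :\ p).
    apply/negP => /minV/(_ (subD1set _ _)) eqV.
    by move: Vp; rewrite -eqV !inE eqxx.
  rewrite negb_forall => /existsP[C]; rewrite negb_imply negbK => /andP[maxC /eqP VC0].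
  exists C => // q Vq Cq; apply/eqP/negPn/negP => neqp.
  by have := finset.in_set0 q; rewrite -VC0 !inE neqp Vq Cq.
apply/minsetP; split=> // B covB subBV; apply/eqP; rewrite finset.eqEsubset subBV.
apply/fintype.subsetP => p /privV[C maxC privC].
have [q Bq Cq] := meets_maximal_chain covB maxC.
by rewrite -(privC q) ?(fintype.subsetP subBV).
Qed.

Lemma chain_set1 p : chain [set p].
Proof. by apply/chainP => x y; rewrite !inE => /eqP-> /eqP->; apply: comparablexx. Qed.

Variable rk : P -> nat.
Hypothesis rank_rk : rank_function rk.

Let rank_minimal p : minimal_elt p -> rk p = 1%N := (proj1 rank_rk) p.
Let rank_covered p q : covered_by p q -> rk q = (rk p).+1 := (proj2 rank_rk) p q.

(** Induction on the number of elements strictly between [p] and [q]: an intermediate [z] splits the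
    interval into two smaller ones. *)
Lemma rank_lt p q : (p < q)%O -> (rk p < rk q)%N.
Proof.
move: {2}#|_| (leqnn #|[set z | (p < z < q)%O]|) => n.
elim: n p q => [|n IH] p q.
  rewrite leqn0 cards_eq0 => /eqP pq0 ltpq.
  rewrite (@rank_covered p q) // /covered_by ltpq; apply/forallP => z.
  by have := finset.in_set0 z; rewrite -pq0 inE => ->.
have [cov|] := boolP [forall z, ~~ (p < z < q)%O].
  by move=> _ ltpq; rewrite (@rank_covered p q) // /covered_by ltpq.
rewrite negb_forall => /existsP[z]; rewrite negbK => pzq le _.
have [ltpz ltzq] := andP pzq.
apply: (ltn_trans (IH p z _ ltpz) (IH z q _ ltzq)); rewrite -ltnS; apply: leq_trans le.
  apply/proper_card/fintype.properP; split.
    apply/fintype.subsetP => x; rewrite !inE => /andP[-> /lt_trans]; exact.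
  by exists z; rewrite !inE // ltxx andbF.
apply/proper_card/fintype.properP; split.
  by apply/fintype.subsetP => x; rewrite !inE => /andP[/(lt_trans ltpz)-> ->].
by exists z; rewrite !inE // ltxx.
Qed.

Lemma rank_comparable_lt p q : (p >=< q)%O -> (rk p < rk q)%N -> (p < q)%O.
Proof.
move=> /comparable_ltgtP[//|/rank_lt|->]; last by rewrite ltnn.
by move=> /ltn_trans h /h; rewrite ltnn.
Qed.

Lemma rank_comparable_eq p q : (p >=< q)%O -> rk p = rk q -> p = q.
Proof. by move=> /comparable_ltgtP[||->] // /rank_lt /[swap] ->; rewrite ltnn. Qed.

(** Anything above the element of largest rank would be comparable with all of [C], hence in [C]. *)
Lemma maximal_chain_top C p : maximal_chain C -> p \in C ->
  exists t, [/\ t \in C, maximal_elt t & forall q, q \in C -> (rk q <= rk t)%N].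
Proof.
move=> /maximal_chainP[/chainP chC maxC] Cp.
case: (arg_maxnP rk Cp) => t Ct ub.
have {}ub q : q \in C -> (rk q <= rk t)%N by apply: ub.
exists t; split=> //.
apply/forallP => q; apply/negP => lttq.
suff /ub : q \in C by rewrite leqNgt rank_lt.
apply: maxC => x Cx; apply: le_comparable; apply: le_trans (ltW lttq).
have [//|/rank_lt|//] := comparable_ltgtP (chC x t Cx Ct).
by rewrite ltnNge ub.
Qed.

(** The element of largest rank in [C] below [p] is covered by [p] in the whole poset, since
    anything strictly between could be added to [C]. If there is none, [p] is minimal and has rank
    1. *)
Lemma maximal_chain_pred C p : maximal_chain C -> p \in C -> (1 < rk p)%N ->
  exists2 q, q \in C & rk p = (rk q).+1.
Proof.
move=> /maximal_chainP[/chainP chC maxC] Cp gt1.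
have [/existsP[q0 Cq0]|none] := boolP [exists q, (q \in C) && (q < p)%O].
  case: (@arg_maxnP _ q0 [pred q | (q \in C) && (q < p)%O] rk Cq0) => q /andP[Cq ltqp] ub; exists q => //.
  have {}ub x : x \in C -> (x < p)%O -> (rk x <= rk q)%N.
    by move=> Cx ltxp; apply: ub; rewrite /= Cx.
  apply: rank_covered; rewrite /covered_by ltqp; apply/forallP => z.
  apply/negP => /andP[ltqz ltzp].
  suff Cz : z \in C by have := ub z Cz ltzp; rewrite leqNgt rank_lt.
  apply: maxC => x Cx; have [ltxp|ltpx|->] := comparable_ltgtP (chC x p Cx Cp).
  - apply: lt_comparable; apply: le_lt_trans ltqz.
    have [//|/rank_lt|//] := comparable_ltgtP (chC x q Cx Cq).
    by rewrite ltnNge ub.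
  - by apply: gt_comparable; apply: lt_trans ltpx.
  - exact: gt_comparable.
suff minp : minimal_elt p by rewrite rank_minimal in gt1.
have geC x : x \in C -> (p <= x)%O.
  move=> Cx; have [ltxp|//|//] := comparable_ltgtP (chC x p Cx Cp).
  by case/existsP: none; exists x; rewrite Cx.
apply/forallP => z; apply/negP => ltzp; case/existsP: none.
exists z; rewrite ltzp andbT; apply: maxC => x /geC lepx.
by apply: gt_comparable; apply: lt_le_trans lepx.
Qed.

Lemma maximal_chain_rank C t n : maximal_chain C -> t \in C -> (0 < n <= rk t)%N ->
  exists2 q, q \in C & rk q = n.
Proof.
move=> maxC Ct /andP[n_gt0]; move E : (rk t - n)%N => m.
elim: m t Ct E => [|m IH] t Ct E le.
  by exists t => //; apply/eqP; rewrite eqn_leq le andbT -subn_eq0 E.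
have ltn : (n < rk t)%N by rewrite -subn_gt0 E.
have [q Cq eqt] := maximal_chain_pred maxC Ct (leq_ltn_trans n_gt0 ltn).
have leq : (n <= rk q)%N by rewrite -ltnS -eqt.
by apply: (IH q) => //; apply/eqP; rewrite -eqSS -subSn // -eqt E.
Qed.

End Chains.

(** * Passing between maximal chains and covers of P and of P_S *)

Section RankSelection.
Variables (d : Order.disp_t) (P : finPOrderType d) (rk : P -> nat) (S : pred nat).
Hypothesis rank_rk : rank_function rk.
Hypothesis S_gt0 : forall n, S n -> (0 < n)%N.

Local Notation PS := (rank_selected rk S).
Local Notation incl := (val : PS -> P).
Implicit Types (p q t : P) (x y : PS).

Lemma incl_comparable x y : (incl x >=< incl y)%O = (x >=< y)%O.
Proof. by rewrite /Order.comparable !Order.le_val. Qed.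

Lemma rank_selectedP x : S (rk (incl x)).
Proof. exact: (valP x). Qed.

(** The set T of the overview; only ranks in [S] that occur in [P] count. A chain through it misses
    P_S. *)
Definition low_maximal : {set P} :=
  [set t | maximal_elt t && [forall q, S (rk q) ==> (rk t < rk q)%N]].

Lemma low_maximalP t : reflect
  (maximal_elt t /\ forall q, S (rk q) -> (rk t < rk q)%N) (t \in low_maximal).
Proof.
rewrite inE; apply: (iffP andP) => -[maxt lowt]; split=> //.
  by move=> q; apply/implyP; move/forallP: lowt; apply.
by apply/forallP => q; apply/implyP; apply: lowt.
Qed.

Lemma low_maximal_selected C t x : chain C -> t \in C -> incl x \in C ->
  t \notin low_maximal.
Proof.
move=> /chainP chC Ct Cx; apply/negP => /low_maximalP[/forallP maxt lowt].
have ltt := lowt _ (rank_selectedP x).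
by have := maxt (incl x); rewrite (rank_comparable_lt rank_rk (chC _ _ Ct Cx) ltt).
Qed.

(** Any maximal chain of [P] containing the image of [C] works: its trace on P_S is a chain
    containing [C]. *)
Lemma extend_maximal_chain (C : {set PS}) : maximal_chain C ->
  exists2 C', maximal_chain C' & incl @^-1: C' = C.
Proof.
move=> /maxsetP[/chainP chC maxC].
have [C' maxC' subCC'] : {C' | maximal_chain C' & incl @: C \subset C'}.
  apply: maxset_exists; apply/chainP => _ _ /imsetP[x Cx ->] /imsetP[y Cy ->].
  by rewrite incl_comparable chC.
exists C' => //; have /maximal_chainP[/chainP chC' _] := maxC'.
apply: maxC; last first.
  by apply/fintype.subsetP => x Cx; rewrite inE (fintype.subsetP subCC') ?imset_f.
by apply/chainP => x y; rewrite !inE -incl_comparable; apply: chC'.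
Qed.

(** Excludes exactly the maximal elements whose rank is outside [S] but lies between two ranks in
    [S] that occur in [P]. *)
Hypothesis gap_free : forall t, maximal_elt t ->
  (forall q, S (rk q) -> (rk t < rk q)%N) \/
  (forall q, S (rk q) -> (rk q <= rk t)%N \/ S (rk t)).

(** Let [x] be comparable with the trace of [C], and [t] the top of [C]. If [x] has rank at most
    that of [t], then [C] has an element of the same rank, which must be [x]. Otherwise [gap_free]
    puts [t] in P_S, and [t < x] contradicts maximality. *)
Lemma restrict_maximal_chain (C : {set P}) : maximal_chain C ->
  (forall t, t \in C -> t \notin low_maximal) -> maximal_chain (incl @^-1: C).
Proof.
move=> maxC highC; have /maximal_chainP[/chainP chC CC] := maxC.
apply/maximal_chainP; split.
  by apply/chainP => x y; rewrite !inE -incl_comparable; apply: chC.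
move=> x compx; rewrite inE; apply: contrapT => /negP CNx.
have [p Cp] : exists p, p \in C.
  apply: contrapT => C0; case/negP: CNx; apply: CC => p Cp; case: C0; by exists p.
have [t [Ct maxt _]] := maximal_chain_top rank_rk maxC Cp.
case: (gap_free maxt) => [lowt|/(_ _ (rank_selectedP x)) hight].
  by have := highC t Ct; move/negP; case; apply/low_maximalP.
have CSx q : q \in C -> S (rk q) -> (q >=< incl x)%O.
  move=> Cq Sq; have := compx (Sub q Sq : PS).
  by rewrite inE SubK -incl_comparable SubK; apply.
have [lext|ltxt] := leqP (rk (incl x)) (rk t).
  have [|q Cq eqq] := maximal_chain_rank (n := rk (incl x)) rank_rk maxC Ct.
    by rewrite lext andbT; apply/S_gt0/rank_selectedP.
  have Sq : S (rk q) by rewrite eqq rank_selectedP.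
  case/negP: CNx; rewrite -(rank_comparable_eq rank_rk (CSx _ Cq Sq)) //.
case: hight => [|St]; first by rewrite leqNgt ltxt.
have := rank_comparable_lt rank_rk (CSx _ Ct St) ltxt.
by move/forallP: maxt => /(_ (incl x)) /negbTE->.
Qed.

(** A private chain of [x] in P_S extends to [P]; it meets P_S, so it avoids [low_maximal]. For a
    low maximal [p], any maximal chain through [p] is private: it misses P_S and has no other
    maximal element. *)
Lemma lift_minimal_vertex_cover (V : {set PS}) : minimal_vertex_cover V ->
  minimal_vertex_cover (incl @: V :|: low_maximal).
Proof.
move=> /minimal_vertex_coverP[covV privV]; apply/minimal_vertex_coverP; split.
  apply: vertex_coverP => C maxC.
  have [[t Ct lowt]|none] := pselect (exists2 t, t \in C & t \in low_maximal).
    by exists t; rewrite // inE lowt orbT.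
  have [|x Vx] := meets_maximal_chain covV (restrict_maximal_chain maxC _).
    by move=> t Ct; apply/negP => lowt; apply: none; exists t.
  by rewrite inE => Cx; exists (incl x); rewrite // inE imset_f.
move=> p; rewrite inE => /orP[/imsetP[x Vx ->]|lowp].
  have [C maxC privC] := privV x Vx; have [C' maxC' eqC] := extend_maximal_chain maxC.
  have /maximal_chainP[chC' _] := maxC'.
  have [y Vy Cy] := meets_maximal_chain covV maxC.
  exists C' => // q; rewrite inE => /orP[/imsetP[z Vz ->]|lowq] Cq.
    by rewrite (privC z) // -eqC inE.
  have C'y : incl y \in C' by rewrite -eqC inE in Cy.
  by have := low_maximal_selected chC' Cq C'y; rewrite lowq.
have [C maxC] := maxset_exists (chain_set1 p); rewrite finset.sub1set => Cp.
have /maximal_chainP[/chainP chC _] := maxC.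
exists C => // q; rewrite inE => /orP[/imsetP[z _ ->]|lowq] Cq.
  have := low_maximal_selected (introT (chainP _) chC) Cp Cq.
  by rewrite lowp.
case/low_maximalP: lowp => /forallP maxp _; case/low_maximalP: lowq => /forallP maxq _.
have := chC q p Cq Cp; case: comparableP (maxp q) (maxq p) => //.
Qed.

(** The lift adds the same number of elements to every cover, as [low_maximal] is disjoint from
    P_S. *)
Lemma unmixed_rank_selected : unmixed_poset P -> unmixed_poset PS.
Proof.
move=> unmP V W minV minW.
have card_lift (U : {set PS}) : #|incl @: U :|: low_maximal| = (#|U| + #|low_maximal|)%N.
  rewrite cardsU (_ : _ :&: _ = finset.set0) ?cards0 ?subn0.
    by rewrite card_imset //; apply: val_inj.
  apply/setP => p; rewrite finset.in_setI finset.in_set0; apply/andP => -[/imsetP[x _ ->]].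
  by move/low_maximalP => [_ /(_ _ (rank_selectedP x))]; rewrite ltnn.
have := unmP _ _ (lift_minimal_vertex_cover minV) (lift_minimal_vertex_cover minW).
by rewrite !card_lift => /addIn.
Qed.

End RankSelection.

(** * Absence of gaps for intervals of ranks and for pure posets *)

Theorem lemma3p2 (k : fieldType) (d : Order.disp_t) (P : finPOrderType d)
    (r : nat) (unmixedP : unmixed_poset P) :
  (forall rk : P -> nat, rank_function rk -> poset_rank rk = r ->
     forall i j : nat, (1 <= i)%N -> (i + j <= r)%N ->
       unmixed_ideal
         (partial_flag_ideal k rk [pred n | (i <= n <= i + j)%N]))
  /\
  (forall rk : P -> nat, pure rk -> poset_rank rk = r ->
     forall S : pred nat, (forall n, S n -> (1 <= n <= r)%N) ->
       unmixed_ideal (partial_flag_ideal k rk S)).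
Proof.
split=> [rk rank_rk _ i j i_gt0 _ | rk [rank_rk pure_rk] _ S S_le].
  apply/unmixed_flag_ideal/unmixed_rank_selected => // [n /andP[/(leq_trans i_gt0)]//|t maxt].
  (* For an interval, a rank that is at least [i] and below some rank in the interval lies in it. *)
  have [lt_ti|le_it] := ltnP (rk t) i; [left|right] => q /= /andP[leiq leqij].
    exact: leq_trans lt_ti leiq.
  have [|ltq] := leqP (rk q) (rk t); first by left.
  by right; rewrite le_it (leq_trans (ltnW ltq)).
apply/unmixed_flag_ideal/unmixed_rank_selected => // [n /S_le/andP[]//|t maxt].
(* In the pure case every maximal element has the largest rank of [P], attained at [s]. *)
right=> q _; left; case: (@arg_maxnP _ q xpredT rk isT) => s _ ub.
have {}ub p : (rk p <= rk s)%N by apply: ub.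
rewrite (pure_rk t s) //; apply/forallP => p; apply/negP => /(rank_lt rank_rk).
by rewrite ltnNge ub.
Qed.
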